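(* Assume that $g$ defines an elliptical family on $\mathbb{R}^p$ and satisfies G1, G2 and Gp, and let $\mathcal{X}=\{x_1,\ldots,x_n\}\subset\mathbb{R}^p$ be a data set. Let $A$ be a Borel set in $\mathbb{R}^p$ such that the number of points, $m$, in the set $\mathcal{X}\cap A$ satisfies $m>2$ if $p=1$, and $m>\frac{p\gamma}{\gamma-p/2}$ in the case $p>1$, where $\gamma$ is the constant which appears in Gp, and assume that the points in $\mathcal{X}\cap A$ are in general position. Let $(\hat\theta_{s,n},\hat\pi_{s,n})$ be an MLE(s) and define, for every $\theta\in\Theta$, $$\pi^*(\theta):=\frac{\mathbb{P}_\theta(A)-P_n(A)}{\mathbb{P}_\theta(A)}.$$ If $\hat\pi_{s,n}=0$, then $\hat\theta_{s,n}$ is an MLE(c). If $\hat\pi_{s,n}>0$, then $\hat\pi_{s,n}=\pi^*(\hat\theta_{s,n})$ and $\hat\theta_{s,n}$ is an MLE(r) restricted to $\Theta_A^\alpha$ for $\alpha=P_n(A)$.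
   Context: $\mathcal{M}^+_{p\times p}$ is the set of positive definite symmetric $p\times p$ matrices and $\Theta=\mathbb{R}^p\times\mathcal{M}^+_{p\times p}$. Elliptical family: for a nonincreasing $g:[0,\infty)\to[0,\infty)$, the family $\{\mathbb{P}_\theta:\theta\in\Theta\}$ of probabilities on $\mathbb{R}^p$ with Lebesgue densities $f_\theta(x)=|\Sigma|^{-1/2}g((x-\mu)^T\Sigma^{-1}(x-\mu))$, $\theta=(\mu,\Sigma)$. Conditions. G1: there is a strictly decreasing sequence $t_k\to0$ with $g(t_k)<g(t_{k+1})$ for every $k$. G2: $g$ is continuous. Gp: if $p>1$, there exists $\gamma>p/2$ with $\lim_{r\to\infty}r^\gamma g(r)=0$. Points of $\mathbb{R}^p$ are in general position if no $p+1$ of them lie in a common (affine) hyperplane. $P_n$ is the empirical distribution of $\mathcal{X}$: $P_nh=\frac1n\sum_ih(x_i)$; convention $0\times\infty=0$. Estimators based on $\mathcal{X}$ and $A$: - MLE(s): $(\hat\theta,\hat\pi)$ maximizing over $\Theta\times[0,1)$ the function $P_n\big(I_A\log((1-\pi)f_\theta)+I_{A^c}\log((1-\pi)\mathbb{P}_\theta(A^c)+\pi)\big)$. - MLE(c): $\hat\theta$ maximizing over $\Theta$ the function $P_n\big(I_A\log f_\theta+I_{A^c}\log\mathbb{P}_\theta(A^c)\big)$. - MLE(r) restricted to $\Theta_A^\alpha:=\{\theta\in\Theta:\mathbb{P}_\theta(A)\ge\alpha\}$: $\hat\theta$ maximizing $P_n\big(I_A\log(f_\theta/\mathbb{P}_\theta(A))\big)$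 over $\Theta_A^\alpha$. *)

(* Defs.v *)
From HB Require Import structures.
From mathcomp Require Import all_boot all_order all_algebra.
From mathcomp Require Import all_classical all_reals all_analysis.
From mathcomp Require Import measurable_realfun.

Set Implicit Arguments.
Unset Strict Implicit.
Unset Printing Implicit Defensive.

Import Order.TTheory GRing.Theory Num.Theory.
Import numFieldNormedType.Exports.

Local Open Scope classical_set_scope.
Local Open Scope ring_scope.

Definition borelRn (R : realType) (p : nat) :=
  g_sigma_algebraType (@open 'cV[R]_p).

Section borelRn_measurability.
Context {R : realType}.

Lemma measurable_borelRn_coord p (i : 'I_p) :
  measurable_fun [set: borelRn R p]
    (fun v => (v : 'cV[R]_p) i ord0 : measurableTypeR R).
Proof.
apply: (measurability _ (RGenOInfty.measurableE R)) => //= _ [_ [x ->] <-].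
rewrite setTI; apply: sub_sigma_algebra; apply: open_comp.
  by move=> v _; exact: coord_continuous.
exact: interval_open.
Qed.

Lemma measurable_borelRnP d (T : measurableType d) p (f : T -> borelRn R p) :
  (forall i, measurable_fun [set: T]
    (fun x => (f x : 'cV[R]_p) i ord0 : measurableTypeR R)) ->
  measurable_fun [set: T] f.
Proof.
move=> mf; apply: (@measurability _ _ T (borelRn R p) setT f (@open 'cV[R]_p)) => //.
move=> _ [U oU <-]; rewrite setTI.
pose B (qk : (p.-tuple rat * nat)%type) : set 'cV[R]_p :=
  [set v | forall i, ball (ratr (tnth qk.1 i) : R) (qk.2.+1%:R^-1) (v i ord0)].
have mB qk : measurable (f @^-1` (B qk)).
  have -> : f @^-1` (B qk) = \bigcap_(i in [set: 'I_p])
      ((fun x => (f x : 'cV[R]_p) i ord0) @^-1`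
         ball (ratr (tnth qk.1 i) : R) (qk.2.+1%:R^-1)).
    by apply/seteqP; split => [x Bx i _|x Bx i]; [exact: Bx|exact: (Bx i)].
  apply: fin_bigcap_measurable => // i _.
  rewrite -[X in measurable X]setTI; apply: mf => //; exact: measurable_ball.
have -> : f @^-1` U = \bigcup_qk
    (if `[< B qk `<=` U >] then f @^-1` (B qk) else set0).
  apply/seteqP; split => [x Ux|x [qk _]]; last first.
    by case: ifPn => // /asboolP BU Bx; exact: BU.
  have /nbhs_ballP[e /= e0 eU] : nbhs (f x : 'cV[R]_p) U.
    by apply: open_nbhs_nbhs; split.
  have e20 : 0 < e / 2 by rewrite divr_gt0.
  have [k kl] : exists k : nat, k.+1%:R^-1 < e / 2 :> R.
    have [N _ /(_ N (leqnn N)) hN] := near_infty_natSinv_lt (PosNum e20).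
    by exists N.
  have kp : 0 < k.+1%:R^-1 :> R by rewrite invr_gt0.
  have hq i : {q : rat | ball (ratr q : R) (k.+1%:R^-1) ((f x : 'cV[R]_p) i ord0)}.
    apply: cid.
    have /rat_in_itvoo[q] : (f x : 'cV[R]_p) i ord0 - k.+1%:R^-1 <
        (f x : 'cV[R]_p) i ord0 + k.+1%:R^-1 by rewrite ltrBlDr -addrA ltrDl addr_gt0.
    rewrite in_itv/= => /andP[q1 q2]; exists q.
    by rewrite /ball/= ltr_distl q1 q2.
  exists ([tuple sval (hq i) | i < p], k) => //=.
  have -> : `[< B ([tuple sval (hq i) | i < p], k) `<=` U >]; last first.
    by move=> i /=; rewrite tnth_mktuple; exact: svalP (hq i).
  apply/asboolP => v Bv; apply: eU; split => // i j; rewrite ord1.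
  have := Bv i; rewrite /= tnth_mktuple => Bvi.
  have := svalP (hq i) => /= hqi.
  have b1 := ball_sym (le_ball (ltW kl) hqi).
  have b2 := le_ball (ltW kl) Bvi.
  by rewrite (splitr e); exact: ball_triangle b1 b2.
apply: countable_bigcupT_measurable => [|qk]; first exact: countableP.
by case: ifP => // _; exact: mB.
Qed.

End borelRn_measurability.

Section lebesgue_step.
Context {R : realType} (p : nat).

Definition consRn (tv : (measurableTypeR R * borelRn R p)%type) :
    borelRn R p.+1 :=
  \col_(i < p.+1) oapp (fun j => (tv.2 : 'cV[R]_p) j ord0) tv.1 (unlift ord0 i).

Definition unconsRn (v : borelRn R p.+1) :
    (measurableTypeR R * borelRn R p)%type :=
  ((v : 'cV[R]_p.+1) ord0 ord0,
   (\col_(j < p) (v : 'cV[R]_p.+1) (lift ord0 j) ord0 : 'cV[R]_p)).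

Lemma consRnK : cancel consRn unconsRn.
Proof.
move=> [t v]; rewrite /unconsRn /consRn mxE unlift_none /=; congr pair.
by apply/colP => j; rewrite !mxE liftK.
Qed.

Lemma measurable_consRn : measurable_fun setT consRn.
Proof.
apply: measurable_borelRnP => i.
rewrite (_ : (fun _ => _) = (fun tv : measurableTypeR R * borelRn R p =>
  oapp (fun j => (tv.2 : 'cV[R]_p) j ord0) tv.1 (unlift ord0 i))).
  case: unliftP => [j _|_] /=; last exact: measurable_fst.
  exact: (measurableT_comp (measurable_borelRn_coord j) measurable_snd).
by apply/funext => tv; rewrite mxE.
Qed.

Lemma measurable_unconsRn : measurable_fun setT unconsRn.
Proof.
apply: measurable_fun_pair; first exact: measurable_borelRn_coord.
apply: measurable_borelRnP => i.
rewrite (_ : (fun _ => _) = (fun v : borelRn R p.+1 =>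
   (v : 'cV[R]_p.+1) (lift ord0 i) ord0)).
  exact: measurable_borelRn_coord.
by apply/funext => v; rewrite mxE.
Qed.

Variable m : {sigma_finite_measure set (borelRn R p) -> \bar R}.

(* The product of the Lebesgue measure on R with m, carried to column vectors. *)
Definition lebesgue_step : set (borelRn R p.+1) -> \bar R :=
  pushforward (@lebesgue_measure R \x m)%E consRn.

Let lebesgue_step0 : lebesgue_step set0 = 0%E.
Proof. by rewrite /lebesgue_step /pushforward preimage_set0 measure0. Qed.

Let lebesgue_step_ge0 A : (0 <= lebesgue_step A)%E.
Proof. rewrite /lebesgue_step /pushforward; exact: measure_ge0. Qed.

Let lebesgue_step_sigma_additive : semi_sigma_additive lebesgue_step.
Proof.
move=> F mF tF mUF; rewrite /lebesgue_step /pushforward preimage_bigcup.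
apply: measure_semi_sigma_additive.
- by move=> n; rewrite -[X in measurable X]setTI; exact: measurable_consRn.
- apply/trivIsetP => /= i j _ _ ij; rewrite -preimage_setI.
  by move/trivIsetP : tF => /(_ _ _ _ _ ij) ->//; rewrite preimage_set0.
- rewrite -preimage_bigcup -[X in measurable X]setTI.
  exact: measurable_consRn.
Qed.

HB.instance Definition _ := isMeasure.Build _ _ _ lebesgue_step
  lebesgue_step0 lebesgue_step_ge0 lebesgue_step_sigma_additive.

Let lebesgue_step_sigma_finite : sigma_finite setT lebesgue_step.
Proof.
have /sigma_finiteP[F [TF ndF Foo]] := sigma_finiteT (@lebesgue_measure R).
have /sigma_finiteP[G [TG ndG Goo]] := sigma_finiteT m.
exists (fun k => unconsRn @^-1` (F k `*` G k)).
  rewrite -preimage_bigcup (_ : \bigcup_k (F k `*` G k) = setT) ?preimage_setT//.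
  rewrite -setXTT TF TG predeqE => -[x y]; split.
    by move=> [n _ []/= ? ?]; split; exists n.
  move=> [/= [n _ Fnx] [k _ Gky]]; exists (maxn n k) => //; split.
  - by move: x Fnx; exact/subsetPset/ndF/leq_maxl.
  - by move: y Gky; exact/subsetPset/ndG/leq_maxr.
move=> k; have [mF Fk] := Foo k; have [mG Gk] := Goo k; split.
  rewrite -[X in measurable X]setTI; apply: measurable_unconsRn => //.
  exact: measurableX.
rewrite /lebesgue_step /pushforward -comp_preimage.
rewrite (_ : unconsRn \o consRn = id); last first.
  by apply/funext => tv; exact: consRnK.
by rewrite preimage_id product_measure1E// lte_mul_pinfty// ge0_fin_numE.
Qed.

HB.instance Definition _ := Measure_isSigmaFinite.Build _ _ _ lebesgue_step
  lebesgue_step_sigma_finite.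

End lebesgue_step.

Fixpoint lebesgueRn (R : realType) (p : nat) :
    {sigma_finite_measure set (borelRn R p) -> \bar R} :=
  match p with
  | 0 => @dirac _ (borelRn R 0) (0 : 'cV[R]_0) R
  | q.+1 => lebesgue_step (lebesgueRn R q)
  end.

Lemma lebesgueRn_box (R : realType) (p : nat)
    (B : 'I_p -> set (measurableTypeR R)) :
  (forall i, measurable (B i)) ->
  lebesgueRn R p [set v : 'cV[R]_p | forall i, B i (v i ord0)] =
  (\prod_(i < p) (@lebesgue_measure R (B i) : \bar R))%E.
Proof.
elim: p B => [|p IH] B mB.
  by rewrite big_ord0 /= diracE mem_set// => -[].
rewrite big_ord_recl /= /lebesgue_step /pushforward.
pose C : set (borelRn R p) :=
  [set v : 'cV[R]_p | forall i, B (lift ord0 i) (v i ord0)].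
rewrite (_ : _ @^-1` _ = B ord0 `*` C); last first.
  apply/seteqP; split => [[t v]/= H|[t v]/= [H0 H] i].
    split; first by have := H ord0; rewrite mxE unlift_none.
    by move=> i; have := H (lift ord0 i); rewrite mxE liftK.
  by rewrite mxE; case: unliftP => [j ->|->] //=; exact: H.
rewrite product_measure1E//; first by rewrite (IH (fun i => B (lift ord0 i))).
rewrite (_ : C = \bigcap_(i in [set: 'I_p])
    ((fun v => (v : 'cV[R]_p) i ord0) @^-1` B (lift ord0 i))).
  apply: fin_bigcap_measurable => // i _.
  rewrite -[X in measurable X]setTI.
  exact: (measurable_borelRn_coord i measurableT (mB _)).
by apply/seteqP; split => [v H i _|v H i]; [exact: H|exact: (H i)].
Qed.

Section elliptical.
Context {R : realType} {p : nat}.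
Implicit Types (g : R -> R) (A B : set 'cV[R]_p) (x y : 'cV[R]_p).

Definition posdef (Sigma : 'M[R]_p) : Prop :=
  Sigma^T = Sigma /\
  forall v : 'cV[R]_p, v != 0 -> 0 < (v^T *m Sigma *m v) ord0 ord0.

Definition Theta : set ('cV[R]_p * 'M[R]_p) := [set theta | posdef theta.2].

Implicit Types theta : ('cV[R]_p * 'M[R]_p)%type.

Definition pdf g theta x : R :=
  (\det theta.2) `^ (- 2^-1) *
  g (((x - theta.1)^T *m invmx theta.2 *m (x - theta.1)) ord0 ord0).

Definition Pr g theta B : \bar R :=
  (\int[lebesgueRn R p]_(x in B) (pdf g theta x)%:E)%E.

(* Only the values of g on [0, +oo) matter. *)
Definition elliptical_family g : Prop :=
  [/\ forall r, 0 <= r -> 0 <= g r,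
      forall r s, 0 <= r -> r <= s -> g s <= g r
    & forall theta, Theta theta -> Pr g theta setT = 1%E].

Definition affine_hyperplane (H : set 'cV[R]_p) : Prop :=
  exists (a : 'cV[R]_p) (b : R),
    a != 0 /\ H = [set x | (a^T *m x) ord0 ord0 = b].

Definition general_position (S : set 'cV[R]_p) : Prop :=
  forall y : 'I_p.+1 -> 'cV[R]_p, injective y -> (forall i, S (y i)) ->
  ~ exists2 H, affine_hyperplane H & forall i, H (y i).

Section estimators.
Local Open Scope ereal_scope.
Context {n : nat}.
Variables (g : R -> R) (A : set 'cV[R]_p) (x : 'I_n -> 'cV[R]_p).

Definition empirical (h : 'cV[R]_p -> \bar R) : \bar R :=
  (n%:R^-1)%:E * \sum_(i < n) h (x i).

Definition empirical_set (B : set 'cV[R]_p) : \bar R :=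
  empirical (fun y => (\1_B y)%:E).

Definition maximizes (T : Type) (D : set T) (F : T -> \bar R) (t : T) : Prop :=
  D t /\ forall t', D t' -> F t' <= F t.

(* In \bar R, lne 0 = -oo and 0 * -oo = 0, as the convention 0 x oo = 0 requires. *)
Definition objective_s (tp : ('cV[R]_p * 'M[R]_p) * R) : \bar R :=
  let: (theta, pi) := tp in
  empirical (fun y =>
    (\1_A y)%:E * lne ((1 - pi) * pdf g theta y)%:E +
    (\1_(~` A) y)%:E * lne ((1 - pi)%:E * Pr g theta (~` A) + pi%:E)).

Definition objective_c theta : \bar R :=
  empirical (fun y =>
    (\1_A y)%:E * lne (pdf g theta y)%:E +
    (\1_(~` A) y)%:E * lne (Pr g theta (~` A))).

Definition objective_r theta : \bar R :=
  empirical (fun y =>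
    (\1_A y)%:E * lne ((pdf g theta y)%:E / Pr g theta A)).

Definition Theta_restricted (alpha : \bar R) : set ('cV[R]_p * 'M[R]_p) :=
  [set theta | Theta theta /\ alpha <= Pr g theta A].

Definition MLE_s theta (pi : R) : Prop :=
  maximizes (Theta `*` [set` `[0%R, 1%R[]) objective_s (theta, pi).

Definition MLE_c theta : Prop := maximizes Theta objective_c theta.

Definition MLE_r (alpha : \bar R) theta : Prop :=
  maximizes (Theta_restricted alpha) objective_r theta.

Definition pi_star theta : \bar R :=
  (Pr g theta A - empirical_set A) / Pr g theta A.

End estimators.
End elliptical.

Definition condition_G1 (R : realType) (g : R -> R) : Prop :=
  exists t : R^nat, [/\ decreasing_seq t, t @ \oo --> 0
    & forall k, g (t k) < g (t k.+1)].

Definition condition_G2 (R : realType) (g : R -> R) : Prop :=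
  {within [set` `[0, +oo[], continuous g}.

(* gamma is the constant whose existence Gp asserts. *)
Definition condition_Gp (R : realType) (p : nat) (g : R -> R) (gamma : R) :
    Prop :=
  (1 < p)%N ->
  p%:R / 2 < gamma /\ (r `^ gamma * g r) @[r --> +oo] --> 0.

(* Main.v *)
Require Import Defs.
From HB Require Import structures.
From mathcomp Require Import all_boot all_order all_algebra.
From mathcomp Require Import all_classical all_reals all_analysis.
From mathcomp Require Import measurable_realfun ring lra.

(** With u = 1 - pi, q = P_theta(A) and a = P_n(A), the MLE(s) objective is
    a term depending on theta alone plus a ln u + (1 - a) ln (1 - u q).  If
    pi_s > 0, the maximizer in u is interior, and the critical point equation
    gives u q = a, i.e. pi_s = pi_star.  Substituting u = a / q, which is
    admissible exactly when q >= a, turns the MLE(s) objective into the MLE(r)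
    objective plus the constant a ln a + (1 - a) ln (1 - a). *)

Set Implicit Arguments.
Unset Strict Implicit.
Unset Printing Implicit Defensive.

Import Order.TTheory GRing.Theory Num.Theory.
Import numFieldNormedType.Exports.

Local Open Scope classical_set_scope.
Local Open Scope ring_scope.

(** Fermat's rule: the derivative [a / v - b * q / (1 - v * q)] vanishes at an interior maximum.
    With denominators cleared, the equation keeps its meaning for [q = 0], so it can later serve to
    prove [q] positive. *)
Lemma binomial_loglik_critical (R : realType) (a b q u : R) :
  0 <= q <= 1 -> u \in `]0, 1[ ->
  (forall v : R, v \in `]0, 1[ ->
    a * ln v + b * ln (1 - v * q) <= a * ln u + b * ln (1 - u * q)) ->
  a * (1 - u * q) = b * (u * q).
Proof.
move=> /andP[q0 q1] u01 umax.
have pos (v : R) : v \in `]0, 1[ -> 0 < v /\ 0 < 1 - v * q.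
  rewrite in_itv/= => /andP[v0 v1]; split=> //.
  by rewrite subr_gt0 (le_lt_trans _ v1)// ler_piMr// ltW.
have der (v : R) : v \in `]0, 1[ -> is_derive v 1
    (fun v => a * ln v + b * ln (1 - v * q)) (a / v - b * q / (1 - v * q)).
  move=> /pos[v0 w0].
  have lnv := is_derive1_ln v0.
  have dw : is_derive v 1 (fun v : R => 1 - v * q) (- q).
    by apply: is_derive_eq; rewrite /= /GRing.scale/=; ring.
  have lnw := @is_derive1_comp _ (@ln R) (fun v : R => 1 - v * q) _ _ _
    (is_derive1_ln w0) dw.
  have -> : a / v - b * q / (1 - v * q) =
      a * v^-1 + b * ((1 - v * q)^-1 * - q) by ring.
  exact: is_deriveD (is_deriveZ a lnv) (is_deriveZ b lnw).
have [u0 w0] := pos _ u01.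
have dmax : is_derive u 1
    (fun v => a * ln v + b * ln (1 - v * q)) 0.
  apply: (@derive1_at_max _ _ 0 1) => // v v01.
  exact: @ex_derive (der v v01).
have := der u u01 => du.
have : a / u - b * q / (1 - u * q) = 0.
  by rewrite -(@derive_val _ _ _ _ _ _ _ du) (@derive_val _ _ _ _ _ _ _ dmax).
move=> E; rewrite -[RHS]add0r -(mul0r (u * (1 - u * q))) -E.
by field; rewrite !gt_eqF.
Qed.

(** * Elliptical densities: sign, measurability, total mass, positivity at the data *)

Section density.
Context {R : realType} {p : nat}.
Implicit Types (g : R -> R) (theta : ('cV[R]_p * 'M[R]_p)%type).

(** With [w = invmx S *m v], the form is [w^T *m S *m w]. *)
Lemma posdef_invmx_ge0 (S : 'M[R]_p) (v : 'cV[R]_p) : posdef S ->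
  0 <= (v^T *m invmx S *m v) ord0 ord0.
Proof.
move=> [symS posS].
have nneg (w : 'cV[R]_p) : 0 <= (w^T *m S *m w) ord0 ord0.
  have [->|/posS/ltW//] := eqVneq w 0.
  by rewrite mulmx0 mxE.
(* On a non-invertible matrix [invmx] is the identity, so [nneg] settles that case and invertibility
   of [S] need not be proved. *)
have [uS|nuS] := boolP (S \in unitmx); last by rewrite /invmx (negbTE nuS).
have := nneg (invmx S *m v).
by rewrite trmx_mul trmx_inv symS -!mulmxA mulKVmx.
Qed.

Lemma pdf_ge0 g theta (y : 'cV[R]_p) : (forall r, 0 <= r -> 0 <= g r) ->
  Theta theta -> 0 <= pdf g theta y.
Proof.
by move=> g0 th; rewrite mulr_ge0 ?powR_ge0// g0// posdef_invmx_ge0.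
Qed.

Lemma measurable_quadratic_form (S : 'M[R]_p) (mu : 'cV[R]_p) :
  measurable_fun [set: borelRn R p]
    (fun y => (((y : 'cV[R]_p) - mu)^T *m S *m (y - mu)) ord0 ord0
      : measurableTypeR R).
Proof.
have mc i : measurable_fun [set: borelRn R p]
    (fun y => ((y : 'cV[R]_p) - mu) i ord0 : measurableTypeR R).
  under eq_fun do rewrite !mxE.
  by apply: measurable_funB => //; exact: measurable_borelRn_coord.
under eq_fun do rewrite mxE.
apply: measurable_sum => i; apply: measurable_funM; last exact: mc.
under eq_fun do rewrite mxE.
apply: measurable_sum => j; apply: measurable_funM => //.
by under eq_fun do rewrite mxE; exact: mc.
Qed.

Lemma measurable_pdf g theta : elliptical_family (p := p) g -> Theta theta ->
  measurable_fun [set: borelRn R p] (pdf g theta : _ -> measurableTypeR R).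
Proof.
move=> [_ gdec _] th.
(* [g] is controlled on [0, +oo) only, so it is first extended by [g 0]. *)
have mg : measurable_fun [set: measurableTypeR R]
    ((fun r => g (Num.max 0 r)) : _ -> measurableTypeR R).
  apply: nonincreasing_measurable => // r s rs; apply: gdec.
    by rewrite le_max lexx.
  by rewrite ge_max !le_max lexx/= rs orbT.
have -> : pdf g theta = fun y => (\det theta.2) `^ (- 2^-1) *
    g (Num.max 0 (((y - theta.1)^T *m invmx theta.2 *m (y - theta.1)) ord0 ord0)).
  by apply/funext => y; rewrite max_r// posdef_invmx_ge0.
apply: measurable_funM => //.
exact: (measurableT_comp mg (measurable_quadratic_form _ _)).
Qed.

(** Both masses are nonnegative and add up to 1, so neither is infinite; this moves the later
    computations from [\bar R] to [R]. *)
Lemma Pr_setC g theta (A : set (borelRn R p)) : elliptical_family (p := p) g ->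
  Theta theta -> measurable A ->
  exists q : R, [/\ 0 <= q <= 1, Pr g theta A = q%:E
    & Pr g theta (~` A) = (1 - q)%:E].
Proof.
move=> ell th mA; have [g0 _ /(_ _ th) PrT] := ell.
have PrU : (Pr g theta A + Pr g theta (~` A) = 1)%E.
  rewrite -PrT -(setUv A) /Pr ge0_integral_setU//.
  - exact: measurableC.
  - rewrite setUv; apply/measurable_EFinP.
    exact: measurable_pdf.
  - by move=> y _; rewrite lee_fin pdf_ge0.
  - by apply/disj_setPCl.
have PA0 : (0 <= Pr g theta A)%E.
  by apply: integral_ge0 => y _; rewrite lee_fin pdf_ge0.
have PC0 : (0 <= Pr g theta (~` A))%E.
  by apply: integral_ge0 => y _; rewrite lee_fin pdf_ge0.
move: PrU PA0 PC0.
case: (Pr g theta A) => [q| |]//; case: (Pr g theta (~` A)) => [q'| |]//.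
rewrite -EFinD !lee_fin => -[<-] q0 q'0; exists q.
by split; [rewrite q0 lerDl|by []|rewrite [q + _]addrC addrK].
Qed.

(** The terms of a strictly decreasing sequence stay above its limit 0, so [t 1 > 0] and
    [g (t 1) > g (t 0) >= 0]. *)
Lemma condition_G1_gt0 g : (forall r, 0 <= r -> 0 <= g r) ->
  condition_G1 g -> exists2 r, 0 < r & 0 < g r.
Proof.
move=> g0 [t [tdec t0 gt]].
have tge0 k : 0 <= t k.
  rewrite -(cvg_lim (@Rhausdorff R) t0); apply: nonincreasing_cvgn_ge.
    by move=> i j ij; rewrite tdec.
  by apply/cvg_ex; exists 0.
have tltn : forall k, t k.+1 < t k by apply/decreasing_seqP.
exists (t 1%N); first exact: le_lt_trans (tltn 1%N).
by apply: le_lt_trans (gt 0%N); exact: g0.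
Qed.

(** A centred distribution with a large scalar scatter matrix brings every data point within squared
    radius [r], where [g] is at least [g r > 0]. *)
Lemma exists_pdf_gt0 g n (x : 'I_n -> 'cV[R]_p) :
  elliptical_family (p := p) g -> condition_G1 g ->
  exists2 theta, Theta theta & forall i, 0 < pdf g theta (x i).
Proof.
move=> [g0 gdec _] /(condition_G1_gt0 g0)[r r0 gr].
pose N (y : 'cV[R]_p) := (y^T *m y) ord0 ord0.
have NE y : N y = \sum_j y j ord0 ^+ 2.
  by rewrite /N mxE; apply: eq_bigr => j _; rewrite mxE expr2.
have N0 y : 0 <= N y by rewrite NE sumr_ge0// => j _; rewrite sqr_ge0.
(* This makes [N (x i) / s <= r] for every [i]; the summand 1 keeps [s] positive when all the data
   are 0. *)
pose s := (1 + \sum_i N (x i)) / r.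
have s1 : 0 < 1 + \sum_i N (x i) by rewrite ltr_pwDl// sumr_ge0.
have s0 : 0 < s by rewrite divr_gt0.
exists (0, s%:M) => [|i].
  split=> [|v v0] /=; first exact: tr_scalar_mx.
  rewrite mul_mx_scalar -scalemxAl mxE mulr_gt0// -/(N v) lt_def N0 andbT.
  apply: contra v0 => /eqP; rewrite NE => /psumr_eq0P v0.
  apply/eqP/colP => j; rewrite mxE; apply/eqP.
  by rewrite -sqrf_eq0 v0// => k _; rewrite sqr_ge0.
rewrite /pdf/= subr0 mulr_gt0//.
  by rewrite powR_gt0// det_scalar exprn_gt0.
rewrite invmx_scalar mul_mx_scalar -scalemxAl mxE -/(N _).
apply: (lt_le_trans gr); apply: gdec.
  by rewrite mulr_ge0// invr_ge0 ltW.
rewrite mulrC ler_pdivrMr// /s mulrCA divff ?gt_eqF// mulr1.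
rewrite (bigD1 i)//= [leRHS]addrCA lerDl addr_ge0// sumr_ge0//.
Qed.

End density.

(** * The objectives in real terms *)

Section objectives.
Context {R : realType} {p n : nat}.
Variables (g : R -> R) (A : set 'cV[R]_p) (x : 'I_n -> 'cV[R]_p).
Implicit Types theta : ('cV[R]_p * 'M[R]_p)%type.

Definition frequency : R := n%:R^-1 * \sum_(i < n) \1_A (x i).

(** Since [ln 0 = 0] in [R], this agrees with the extended-real average of the log-density over [A]
    only if the density is positive at the data in [A]. *)
Definition mean_loglik theta : R :=
  n%:R^-1 * \sum_(i < n) \1_A (x i) * ln (pdf g theta (x i)).

Lemma empirical_setE : empirical_set x A = frequency%:E.
Proof. by rewrite /empirical_set /empirical sumEFin -EFinM. Qed.

(** In [\bar R], [-oo] absorbs even [+oo] under addition, so one term decides; the index [i] also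
    makes [n] positive. *)
Lemma empirical_eqNy (h : 'cV[R]_p -> \bar R) i :
  h (x i) = -oo%E -> empirical x h = -oo%E.
Proof.
move=> hi; rewrite /empirical (_ : (\sum_(i < n) _)%E = -oo%E).
  by rewrite gt0_muleNy// lte_fin invr_gt0 ltr0n (leq_ltn_trans _ (ltn_ord i)).
by apply/esum_eqNyP; exists i; rewrite mem_index_enum.
Qed.

Lemma frequency_gt0 i : A (x i) -> 0 < frequency.
Proof.
move=> Ai; rewrite mulr_gt0//.
  by rewrite invr_gt0 ltr0n (leq_ltn_trans _ (ltn_ord i)).
by rewrite (bigD1 i)//= indicE mem_set//= ltr_pwDl// sumr_ge0.
Qed.

Lemma objective_s_eqNy theta pi i : A (x i) -> pdf g theta (x i) = 0 ->
  objective_s g A x (theta, pi) = -oo%E.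
Proof.
move=> Ai fi; apply: (@empirical_eqNy _ i).
by rewrite fi mulr0 le0_lneNy// indicC indicE mem_set//= mul0e adde0 mul1e.
Qed.

Lemma objective_r_eqNy theta i : A (x i) -> pdf g theta (x i) = 0 ->
  objective_r g A x theta = -oo%E.
Proof.
move=> Ai fi; apply: (@empirical_eqNy _ i).
by rewrite fi mul0e le0_lneNy// indicE mem_set//= mul1e.
Qed.

Lemma objective_sE theta pi q : (0 < n)%N ->
  (forall i, A (x i) -> 0 < pdf g theta (x i)) -> pi < 1 ->
  Pr g theta (~` A) = (1 - q)%:E -> 0 < 1 - (1 - pi) * q ->
  objective_s g A x (theta, pi) =
    (mean_loglik theta +
     (frequency * ln (1 - pi) + (1 - frequency) * ln (1 - (1 - pi) * q)))%:E.
Proof.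
move=> n0 f0 pi1 PrC q0; rewrite /objective_s /empirical.
rewrite (eq_bigr (fun i => (\1_A (x i) * ln (pdf g theta (x i)) +
    (\1_A (x i) * ln (1 - pi) +
    (1 - \1_A (x i)) * ln (1 - (1 - pi) * q)))%:E)); last first.
  move=> i _; rewrite PrC indicC indicE -EFinM -EFinD.
  (* The mixture mass outside [A], rewritten with [u = 1 - pi] as [1 - u q]. *)
  rewrite (_ : (1 - pi) * (1 - q) + pi = 1 - (1 - pi) * q); last by ring.
  rewrite [lne (1 - (1 - pi) * q)%:E]lne_EFin//.
  have [/set_mem Ai|_] := boolP (x i \in A).
    have fi := f0 _ Ai; have pi0 : 0 < 1 - pi by rewrite subr_gt0.
    rewrite lne_EFin; last exact: mulr_gt0.
    rewrite -!EFinM -EFinD lnM//; congr EFin; rewrite /= !(mul1r, subrr, mul0r, addr0).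
    exact: addrC.
  by rewrite [in LHS]mul0e add0e mul1e; congr EFin; rewrite /= !(mul0r, add0r, subr0, mul1r).
rewrite sumEFin -EFinM; congr EFin.
rewrite !big_split/= -!mulr_suml sumrB sumr_const card_ord.
rewrite /mean_loglik /frequency; field.
by rewrite pnatr_eq0 -lt0n.
Qed.

Lemma objective_rE theta q :
  (forall i, A (x i) -> 0 < pdf g theta (x i)) -> 
  Pr g theta A = q%:E -> 0 < q ->
  objective_r g A x theta = (mean_loglik theta - frequency * ln q)%:E.
Proof.
move=> f0 PrA q0; rewrite /objective_r /empirical.
rewrite (eq_bigr (fun i => (\1_A (x i) * ln (pdf g theta (x i)) -
    \1_A (x i) * ln q)%:E)); last first.
  move=> i _; rewrite PrA inver gt_eqF// -EFinM indicE.
  have [/set_mem Ai|_] := boolP (x i \in A).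
    rewrite mul1e lne_EFin ?divr_gt0 ?f0// ln_div ?posrE ?f0//.
    by congr EFin; rewrite /= !mul1r.
  by rewrite mul0e !mul0r subr0.
rewrite sumEFin -EFinM; congr EFin.
by rewrite sumrB -!mulr_suml /mean_loglik /frequency; ring.
Qed.

Lemma objective_c_s0 theta :
  objective_c g A x theta = objective_s g A x (theta, 0).
Proof.
rewrite /objective_c /objective_s; congr (empirical x _).
by apply/funext => y; rewrite subr0 mul1r mul1e adde0.
Qed.

End objectives.

Theorem proposition2p7 (R : realType) (p : nat) (p_gt0 : (0 < p)%N)
  (g : R -> R) (gamma : R)
  (g_elliptical : elliptical_family (p := p) g)
  (g_G1 : condition_G1 g) (g_G2 : condition_G2 g)
  (g_Gp : condition_Gp p g gamma)
  (n : nat) (x : 'I_n -> 'cV[R]_p)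
  (A : set (borelRn R p)) (A_borel : measurable A)
  (m : nat) (m_card : (range x `&` A #= `I_m)%card)
  (m_gt_p1 : p = 1%N -> (2 < m)%N)
  (m_gt_p : (1 < p)%N -> p%:R * gamma / (gamma - p%:R / 2) < m%:R)
  (XA_general : general_position (range x `&` A))
  (theta_s : 'cV[R]_p * 'M[R]_p) (pi_s : R)
  (mle_s : MLE_s g A x theta_s pi_s) :
  (pi_s = 0 -> MLE_c g A x theta_s) /\
  (0 < pi_s ->
     pi_s%:E = pi_star g A x theta_s /\
     MLE_r g A x (empirical_set x A) theta_s).
Proof.
have [g0 _ _] := g_elliptical.
case: mle_s => -[/= th_s]; rewrite in_itv/= => /andP[pis0 pis1] max_s.
have {}max_s theta (pi : R) : Theta theta -> 0 <= pi < 1 ->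
    (objective_s g A x (theta, pi) <= objective_s g A x (theta_s, pi_s))%E.
  by move=> th pi01; apply: max_s; split=> //=; rewrite in_itv.
(* The MLE(c) objective is the slice [pi = 0] of the MLE(s) objective, so a global maximizer lying
   in that slice is maximal there. *)
split=> [pi0|{}pis0].
  split=> // theta th; rewrite !objective_c_s0 -[in leRHS]pi0.
  by apply: max_s => //; rewrite lexx/=.
(* The lower bounds on [m] put a data point in [A], whence P_n(A) > 0. *)
have m0 : (0 < m)%N.
  move: p_gt0; rewrite leq_eqVlt => /predU1P[p1|p1].
    exact: leq_trans (m_gt_p1 (esym p1)).
  have [gp _] := g_Gp p1; rewrite -(ltr0n R); apply: le_lt_trans (m_gt_p p1).
  have gamma0 : 0 <= gamma.
    by apply: le_trans (ltW gp); rewrite divr_ge0.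
  by rewrite divr_ge0 ?mulr_ge0// subr_ge0 ltW.
have [i0 Ai0] : exists i, A (x i).
  apply: contrapT => noA.
  have XA0 : range x `&` A = set0.
    by rewrite -subset0 => _ [[i _ <-] Ai]; apply: noA; exists i.
  move: m_card; rewrite XA0 card_eq_sym card_eq0 => /eqP I0.
  by suff : set0 0%N by []; rewrite -I0.
have n0 : (0 < n)%N := leq_ltn_trans (leq0n i0) (ltn_ord i0).
pose al := frequency A x.
have al0 : 0 < al := @frequency_gt0 _ _ _ A x i0 Ai0.
have [qs [qs01 PAs PCs]] := Pr_setC g_elliptical th_s A_borel.
have wpos (pi q : R) : 0 < pi < 1 -> 0 <= q <= 1 -> 0 < 1 - (1 - pi) * q.
  by move=> /andP[? ?] /andP[? ?]; nra.
(* Otherwise the maximum would be [-oo], although some parameter has a finite objective. There [pi]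
   is 1/2, since [pi = 0] would give [ln 0] outside [A] when [q = 1]. *)
have fs0 i : A (x i) -> 0 < pdf g theta_s (x i).
  move=> Ai; rewrite lt_def pdf_ge0// andbT; apply/eqP => fi.
  have [theta th f0] := exists_pdf_gt0 x g_elliptical g_G1.
  have [q [q01 _ PC]] := Pr_setC g_elliptical th A_borel.
  have h01 : 0 < (2^-1 : R) < 1 by lra.
  have [h0 h1] : 0 <= (2^-1 : R) < 1 /\ (2^-1 : R) < 1 by split; lra.
  have := max_s theta 2^-1 th h0.
  rewrite (@objective_s_eqNy _ _ _ g A x theta_s pi_s i)//.
  by rewrite (@objective_sE _ _ _ g A x _ _ _ n0 (fun i _ => f0 i) h1 PC (wpos _ _ h01 q01)).
have obj_s (pi : R) : 0 < pi < 1 -> objective_s g A x (theta_s, pi) =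
    (mean_loglik g A x theta_s +
     (al * ln (1 - pi) + (1 - al) * ln (1 - (1 - pi) * qs)))%:E.
  move=> pi01; apply: (@objective_sE _ _ _ g A x) => //; last exact: wpos.
  by case/andP: pi01.
have pis01 : 0 < pi_s < 1 by rewrite pis0.
have crit : al = (1 - pi_s) * qs.
  (* The products [al * (1 - pi_s) * qs] on the two sides cancel. *)
  suff : al * (1 - (1 - pi_s) * qs) = (1 - al) * ((1 - pi_s) * qs) by nra.
  apply: binomial_loglik_critical => // [|v].
    by rewrite in_itv/=; lra.
  rewrite in_itv/= => v01; have v01' : 0 < 1 - v < 1 by lra.
  have := max_s theta_s (1 - v) th_s; rewrite !obj_s// lee_fin lerD2l.
  by rewrite subKr; apply; lra.
have /andP[qs0' qs1] := qs01.
(* By [crit], [al > 0] forces [qs > 0], while [pi_s > 0] and [qs <= 1] force [al < 1]. *)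
have qs0 : 0 < qs by nra.
have al1 : al < 1 by nra.
have pisE : pi_s = (qs - al) / qs by rewrite crit; field; rewrite gt_eqF.
split.
  rewrite /pi_star empirical_setE PAs -EFinB inver gt_eqF//.
  by rewrite -EFinM pisE.
split=> [|theta [th]].
  by split=> //; rewrite empirical_setE PAs lee_fin -/al crit; nra.
have [q [q01 PA PC]] := Pr_setC g_elliptical th A_borel.
rewrite empirical_setE PA lee_fin -/al => alq.
have q0 : 0 < q := lt_le_trans al0 alq.
(* A competitor whose density vanishes at a data point in [A] has MLE(r) objective [-oo], so it
   cannot win. *)
have [[i Ai fi]|nf] := pselect (exists2 i, A (x i) & pdf g theta (x i) = 0).
  rewrite (@objective_r_eqNy _ _ _ g A x theta i) //.
  exact: leNye.
have f0 i : A (x i) -> 0 < pdf g theta (x i).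
  move=> Ai; rewrite lt_def pdf_ge0// andbT.
  by apply/eqP => fi; apply: nf; exists i.
(* The competitor [theta] is paired with its own [pi_star], [(q - al) / q], which lies in [0, 1)
   because [q >= al > 0]. *)
have uq : (1 - (q - al) / q) * q = al by field; rewrite gt_eqF.
have pi01 : 0 <= (q - al) / q < 1.
  by rewrite divr_ge0 ?subr_ge0 ?(ltW q0)//= ltr_pdivrMr// mul1r; lra.
have := max_s theta _ th pi01.
have uq1 : 0 < 1 - (1 - (q - al) / q) * q by rewrite uq subr_gt0.
have /andP[_ pi1] := pi01.
rewrite obj_s// (@objective_sE _ _ _ g A x _ _ _ n0 f0 pi1 PC uq1).
rewrite -crit uq (@objective_rE _ _ _ g A x _ _ f0 PA q0) (@objective_rE _ _ _ g A x _ _ fs0 PAs qs0) !lee_fin.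
(* Both sides now carry the same [al * ln al + (1 - al) * ln (1 - al)]; cancelling it leaves the
   MLE(r) inequality. *)
have lnu (t : R) : 0 < t -> ln (1 - (t - al) / t) = ln al - ln t.
  by move=> t0; rewrite -ln_div//; congr ln; field; rewrite gt_eqF.
rewrite pisE !lnu// -/al; lra.
Qed.
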